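(* Let $p:\mathbb C^n\to\mathbb C$ be a polynomial with integer coefficients and zero constant term. Then $p$ is accurately evaluable on $\mathcal D=\mathbb C^n$ in classical rounded arithmetic if and only if the variety $V(p)$ is allowable.
   Context: **Classical rounded arithmetic (complex).** An algorithm receives its input $x=(x_1,\dots,x_n)\in\mathbb C^n$ exactly. It is a finite directed acyclic graph (DAG) with source nodes carrying the variables $x_i$, computational nodes, possibly branching nodes, and one output (destination) node per branch. Each computational node has two inputs (each a source or the output of another computational node; both inputs may come from the same node), each of which may be negated exactly before use; the node performs one operation $op\in\{+,-,\cdot\}$ and outputs $op(a,b)(1+\delta_i)$, where $\delta_i$ is a complex rounding error variable specific to that node (different nodes have independent errors), arbitrary subject to $|\delta_i|\le\epsilon$, where $0<\epsilon<1$ is the machine precision. No constants are available. Branching nodes make exact comparisons ($=$) of intermediate quantities and the algorithm continues according to the outcome. The output on input $x$ with error vector $\delta=(\delta_1,\dots,\delta_m)$ is $p_{comp}(x,\delta)$; an algorithm for $p$ must satisfy $p_{comp}(x,0)=p(x)$. **Accuracy.** The algorithm is accurate for $p$ on $\mathcal D$ if for every $0<\eta<1$ there is $0<\epsilon<1$ such that for all $x\in\mathcal D$ and all $\delta$ with $|\delta_i|\le\epsilon$ for all $i$: $|p_{comp}(x,\delta)-p(x)|\le\eta|p(x)|$. The polynomial $p$ is accurately evaluable on $\mathcal D$ if some (branching or non-branching) algorithm is accurate for $p$ on $\mathcal D$. **Allowability.** $V(p)=\{x\in\mathbb C^n: p(x)=0\}$ is allowable if it is a union of intersections of sets of the form $Z_i=\{x:x_i=0\}$,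 $S_{ij}=\{x:x_i+x_j=0\}$, $D_{ij}=\{x:x_i-x_j=0\}$. *)

(* Defs.v *)
From mathcomp Require Import all_boot all_order all_algebra.
From mathcomp Require Import mpoly complex.
From mathcomp Require Import classical_sets reals.

Set Implicit Arguments.
Unset Strict Implicit.
Unset Printing Implicit Defensive.

Import Order.TTheory GRing.Theory Num.Theory.

Local Open Scope ring_scope.
Local Open Scope classical_set_scope.

Inductive arith_op : Type := Add | Sub | Mul.

(* [algorithm V] is the part of an algorithm that remains to be executed once
   the quantities named by [V] (sources and already computed nodes) are
   available; a complete algorithm with n inputs is an [algorithm 'I_n].
   [Compute] adds one node, called [None] in its continuation, and the inputs of
   a node range over all earlier quantities, so that each branch is a DAG listed
   in topological order. In [(s, v) : bool * V], [s = true] means that the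
   quantity [v] is negated (exactly) before use. [Branch u v a b] continues with
   [a] if [u = v] and with [b] otherwise. There is no constructor for
   constants. *)
Inductive algorithm (V : Type) : Type :=
  | Output of V
  | Compute of arith_op & bool * V & bool * V & algorithm (option V)
  | Branch of V & V & algorithm V & algorithm V.

(* The computational nodes of an algorithm, over all its branches: each of them
   carries its own rounding error. *)
Fixpoint comp_node (V : Type) (a : algorithm V) : Type :=
  match a with
  | Output _ => void
  | Compute _ _ _ b => option (comp_node b)
  | Branch _ _ b c => (comp_node b + comp_node c)%type
  end.

Section Complex.
Variable R : realType.
Local Notation C := R[i].

Definition op_eval (op : arith_op) (a b : C) : C :=
  match op with Add => a + b | Sub => a - b | Mul => a * b end.

Definition input_eval (V : Type) (env : V -> C) (u : bool * V) : C :=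
  if u.1 then - env u.2 else env u.2.

(* For [V := 'I_n] and [env := x] this is p_comp(x, delta). *)
Fixpoint p_comp (V : Type) (a : algorithm V) (env : V -> C) :
    (comp_node a -> C) -> C :=
  match a return (comp_node a -> C) -> C with
  | Output v => fun _ => env v
  | Compute op u v b => fun delta =>
      let r := op_eval op (input_eval env u) (input_eval env v)
               * (1 + delta None) in
      @p_comp _ b (fun w : option V => if w is Some w' then env w' else r)
             (fun k : comp_node b => delta (Some k))
  | Branch u v b c => fun delta =>
      if env u == env v
      then @p_comp _ b env (fun k : comp_node b => delta (inl k))
      else @p_comp _ c env (fun k : comp_node c => delta (inr k))
  end.

Arguments p_comp {V} a env delta.

Section Polynomial.
Variable n : nat.

Definition poly_eval (p : {mpoly int[n]}) (x : 'I_n -> C) : C :=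
  (map_mpoly (intr : int -> C) p).@[x].

Definition algorithm_for (a : algorithm 'I_n) (p : {mpoly int[n]}) : Prop :=
  forall x : 'I_n -> C, p_comp a x (fun=> 0) = poly_eval p x.

Definition accurate (a : algorithm 'I_n) (p : {mpoly int[n]})
    (D : set ('I_n -> C)) : Prop :=
  forall eta : R, 0 < eta < 1 ->
  exists2 eps : R, 0 < eps < 1 &
    forall x : 'I_n -> C, D x ->
    forall delta : comp_node a -> C, (forall k, `|delta k| <= eps%:C%C) ->
      `|p_comp a x delta - poly_eval p x| <= eta%:C%C * `|poly_eval p x|.

Definition accurately_evaluable (p : {mpoly int[n]}) (D : set ('I_n -> C)) :
    Prop :=
  exists2 a : algorithm 'I_n, algorithm_for a p & accurate a p D.

Definition variety (p : {mpoly int[n]}) : set ('I_n -> C) :=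
  [set x | poly_eval p x = 0].

Definition Zset (i : 'I_n) : set ('I_n -> C) := [set x | x i = 0].
Definition Sset (i j : 'I_n) : set ('I_n -> C) := [set x | x i + x j = 0].
Definition Dset (i j : 'I_n) : set ('I_n -> C) := [set x | x i - x j = 0].

Definition basic_allowable (A : set ('I_n -> C)) : Prop :=
  [\/ exists i, A = Zset i,
      exists i j, A = Sset i j
    | exists i j, A = Dset i j].

(* The empty intersection is the whole space, which for n > 0 is also the basic
   set [Dset i i]. *)
Definition allowable (W : set ('I_n -> C)) : Prop :=
  exists2 F : set (set (set ('I_n -> C))),
    (forall G, F G -> G `<=` basic_allowable) &
    W = \bigcup_(G in F) \bigcap_(A in G) A.

End Polynomial.
End Complex.

Arguments p_comp {R V} a env delta.
Arguments algorithm_for R {n} a p.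
Arguments accurate {R n} a p D.
Arguments accurately_evaluable {R n} p D.
Arguments variety R {n} p.
Arguments allowable {R n} W.

(* Main.v *)
Require Import Defs.
From mathcomp Require Import all_boot all_order all_algebra.
From mathcomp Require Import mpoly complex.
From mathcomp Require Import boolp functions classical_sets reals.
From mathcomp Require Import ring lra.

Set Implicit Arguments.
Unset Strict Implicit.
Unset Printing Implicit Defensive.

Import Order.TTheory GRing.Theory Num.Theory.

Local Open Scope ring_scope.
Local Open Scope classical_set_scope.

(** Both directions rest on the linear forms [x_i - m] with [m] one of [0],
    [x_j], [- x_j]: their zero sets are the sets Z_i, D_ij and S_ij.

    Accurate implies allowable. The error factor of a node occurs in the value
    of that node and in no earlier one, so for generic errors a nonzero new
    value is neither equal nor opposite to any earlier value. Hence which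
    values vanish, and which comparisons succeed, depends only on the equalities
    [x_i = +- x_j] that the input satisfies ([generic_errors]). Now let
    [p x = 0]. At [x] accuracy forces the output to be exactly 0 for all small
    errors; generic errors make the output vanish as well at every [z] that
    satisfies the same equalities as [x], and then accuracy at [z], with a
    tolerance below 1, forces [p z = 0]. If [y] satisfies at least the equalities
    of [x], all but finitely many points of the line from [x] to [y] satisfy
    exactly those, so [p] vanishes at [y] too
    ([accurate_zero_specialization]). So V(p) is the union over its points [x]
    of the intersection of the basic sets through [x].

    Allowable implies accurate. If [p] is not the zero function, V(p) lies in
    the union of the hyperplanes of finitely many forms. On a generic line a
    nonconstant [p] has a root, and this root lies on one of the hyperplanes;
    but a generic line meets a hyperplane at a zero of [p] only if [p] vanishes
    on the whole hyperplane. So there is a form on whose zeros [p] vanishes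
    ([hyperplane_in_zeros]). Forms are
    monic in one variable, so [p] is divisible by this one with an integral
    quotient, and induction on the degree gives [p = c * l_1 * ... * l_k] with
    an integer [c] ([int_poly_factor]). Each form costs one operation and so has
    a small relative error; products keep it small. Multiplication by [c] is
    done by repeated addition of one and the same computed product, starting from
    the exact zero [x_i - x_i], and this also keeps the relative error small
    because [c] is a nonzero integer ([product_evaluable]). *)

(** * Functions that are polynomial along every line *)

Section PolynomialOnLines.
Variable K : closedFieldType.

(** A substitute for polynomial functions on [E] that is stable under affine
    substitutions by definition and reduces every argument to one variable. *)
Definition poly_on_lines (E : lmodType K) (f : E -> K) : Prop :=
  forall a b : E, exists q : {poly K}, forall t, f (a + t *: b) = q.[t].

Section Closure.
Variable E : lmodType K.
Implicit Types f g l : E -> K.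

Lemma poly_on_lines_cst c : poly_on_lines (fun _ : E => c).
Proof. by move=> a b; exists c%:P => t; rewrite hornerC. Qed.

Lemma poly_on_linesD f g : poly_on_lines f -> poly_on_lines g ->
  poly_on_lines (fun x => f x + g x).
Proof.
move=> pf pg a b; have [[q fq] [r gr]] := (pf a b, pg a b).
by exists (q + r) => t; rewrite fq gr hornerD.
Qed.

Lemma poly_on_linesM f g : poly_on_lines f -> poly_on_lines g ->
  poly_on_lines (fun x => f x * g x).
Proof.
move=> pf pg a b; have [[q fq] [r gr]] := (pf a b, pg a b).
by exists (q * r) => t; rewrite fq gr hornerM.
Qed.

Definition linear_form (f : E -> K) : Prop :=
  forall a b t, f (a + t *: b) = f a + t * f b.

Lemma poly_on_lines_linear f : linear_form f -> poly_on_lines f.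
Proof.
move=> lf a b; exists ((f a)%:P + f b *: 'X) => t.
by rewrite lf hornerD hornerZ hornerX hornerC mulrC.
Qed.

Lemma poly_on_lines_comp (E' : lmodType K) (A : E' -> E) f :
  (forall a b, exists b', forall t, A (a + t *: b) = A a + t *: b') ->
  poly_on_lines f -> poly_on_lines (fun x => f (A x)).
Proof.
move=> affA pf a b; have [b' Ab] := affA a b; have [q fq] := pf (A a) b'.
by exists q => t; rewrite Ab fq.
Qed.

(** Two nonzero polynomials in one variable have a common point where neither
    vanishes; this is applied along the line that joins a point where a product
    of some of the functions is nonzero to a point where the next one is. *)
Lemma common_nonzero (I : eqType) (s : seq I) (F : I -> E -> K) :
  (forall i, i \in s -> poly_on_lines (F i)) ->
  (forall i, i \in s -> exists x, F i x != 0) ->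
  exists x, forall i, i \in s -> F i x != 0.
Proof.
move=> pF nzF; pose P s x := \prod_(i <- s) F i x.
suff [_ [x nz]] : poly_on_lines (P s) /\ exists x, P s x != 0.
  by exists x => i si; move: nz; rewrite prodf_seq_neq0 => /allP/(_ i si).
elim: s pF nzF => [|i s IHs] pF nzF.
  have P0 : P [::] = fun=> 1 by apply/funext => x; rewrite /P big_nil.
  by rewrite P0; split; [exact: poly_on_lines_cst | exists 0; rewrite oner_eq0].
have {IHs}[| |pP [x nzx]] := IHs.
- by move=> j sj; apply: pF; rewrite inE sj orbT.
- by move=> j sj; apply: nzF; rewrite inE sj orbT.
have Pi : P (i :: s) = fun x => F i x * P s x.
  by apply/funext => y; rewrite /P big_cons.
have pi : poly_on_lines (F i) by apply: pF; rewrite mem_head.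
rewrite Pi; split; first exact: poly_on_linesM.
have [y nzy] := nzF i (mem_head _ _).
have [q Fq] := pi x (y - x); have [r Pr] := pP x (y - x).
have q0 : q != 0.
  apply: contraNneq nzy => q0.
  by rewrite -[y](addrNK x) addrC -[y - x]scale1r Fq q0 horner0.
have r0 : r != 0.
  by apply: contraNneq nzx => r0;
     rewrite -[x]addr0 -(scale0r (y - x)) Pr r0 horner0.
have /closed_nonrootP [t] : q * r != 0 by rewrite mulf_neq0.
rewrite rootE hornerM => nzt.
by exists (x + t *: (y - x)); rewrite Fq Pr.
Qed.

(** A form of the Nullstellensatz for unions of hyperplanes. If every
    hyperplane contained a point where [f] is nonzero, then on a generic line
    [f] would be nonconstant, hence would have a root, yet would be nonzero at
    the points where the line meets the hyperplanes, which are supposed to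
    contain all the roots. *)
Lemma hyperplane_in_zeros (I : eqType) (s : seq I) (l : I -> E -> K) f :
  poly_on_lines f -> (exists a b, f a != f b) ->
  (forall i, i \in s -> linear_form (l i)) ->
  (forall i, i \in s -> exists v, l i v != 0) ->
  (forall x, f x = 0 -> exists2 i, i \in s & l i x = 0) ->
  exists2 i, i \in s & forall x, l i x = 0 -> f x = 0.
Proof.
move=> pf [a0 [b0 ab]] lin_l nz_l zf; apply: contrapT => no_hyp.
have off i : i \in s -> exists2 x, l i x = 0 & f x != 0.
  move=> si; apply: contrapT => noff; apply: no_hyp; exists i => // x lx.
  by apply/eqP/negP => /negP fx; apply: noff; exists x.
have ptr v : poly_on_lines (fun a => f (a + v)).
  by apply: poly_on_lines_comp pf => a b; exists b => t; rewrite addrAC.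
have pN g : poly_on_lines g -> poly_on_lines (fun x => - g x).
  move=> pg; rewrite (_ : (fun x => _) = fun x => -1 * g x).
    exact: poly_on_linesM (poly_on_lines_cst _) pg.
  by apply/funext => x; rewrite mulN1r.
pose S : seq (option I) := None :: map Some s.
have inS i : Some i \in S -> i \in s by rewrite inE /= (mem_map Some_inj).
have Sin i : i \in s -> Some i \in S by rewrite inE /= (mem_map Some_inj).
(* a direction transverse to the hyperplanes along which [f] varies from [a0] *)
have [v nz_v] : exists v, forall o, o \in S ->
    (if o is Some i then l i v else f (a0 + v) - f a0) != 0.
  apply: (common_nonzero
    (F := fun o v => if o is Some i then l i v else f (a0 + v) - f a0)).
    move=> [i /inS si|_]; first exact/poly_on_lines_linear/lin_l.
    apply: poly_on_linesD (poly_on_lines_cst _).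
    by under eq_fun do rewrite addrC; apply: ptr.
  move=> [i /inS si|_]; first exact: nz_l.
  by exists (b0 - a0); rewrite [a0 + _]addrC addrNK subr_eq0 eq_sym.
(* the point where the line through [a] in the direction [v] meets the
   hyperplane [l i = 0] *)
pose proj i a := a + (- (l i a / l i v)) *: v.
have [a nz_a] : exists a, forall o, o \in S ->
    (if o is Some i then f (proj i a) else f (a + v) - f a) != 0.
  apply: (common_nonzero
    (F := fun o a => if o is Some i then f (proj i a) else f (a + v) - f a)).
    move=> [i /inS si|_]; last exact: poly_on_linesD (ptr _) (pN _ pf).
    apply: poly_on_lines_comp pf => a b; exists (proj i b) => t.
    rewrite /proj lin_l // scalerDr scalerA mulrN mulrA mulrDl opprD scalerDl.
    by rewrite addrACA.
  move=> [i /inS si|_]; last by exists a0; apply: (nz_v None); rewrite mem_head.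
  have [x lx fx] := off i si; exists x.
  by rewrite /proj lx mul0r oppr0 scale0r addr0.
have [q fq] := pf a v.
have /closed_rootP [t] : size q != 1.
  apply/negP => /eqP q1; have := nz_a None (mem_head _ _).
  rewrite -[X in _ - f X]addr0 -[v in a + v]scale1r -[in X in _ - X](scale0r v).
  by rewrite !fq (size1_polyC (p := q)) ?q1 // !hornerC subrr eqxx.
rewrite rootE -fq => /eqP fz; have [i si] := zf _ fz.
rewrite lin_l // => lz; have nzv := nz_v _ (Sin _ si).
have tE : t = - (l i a / l i v).
  by apply: (mulIf nzv); rewrite mulNr divfK //; apply/eqP;
     rewrite -addr_eq0 addrC lz.
by have := nz_a _ (Sin _ si); rewrite /proj -tE fz eqxx.
Qed.

End Closure.
End PolynomialOnLines.

(** * Integer polynomials and their factorization into forms *)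

Section IntegerPolynomials.
Variables (R : realType) (n : nat).
Local Notation C := R[i].
Local Notation point := ('I_n -> C).
Implicit Types (x y : point) (f g : point -> C).

(** The index [None] stands for the constant 0, so that [x_i], [x_i - x_j] and
    [x_i + x_j] are all the difference of a variable and a signed input. *)
Definition with_zero x : option 'I_n -> C :=
  fun o => if o is Some i then x i else 0.

(** The triple [(i, (b, o))] encodes the linear form [x_i - m], where [m] is the
    variable or zero indexed by [o], negated if [b = true]. *)
Definition form : Type := ('I_n * (bool * option 'I_n))%type.
Implicit Type h : form.

Definition form_eval h x : C := x h.1 - input_eval (with_zero x) h.2.

(** Excludes [x_i - x_i] and [x_i + x_i]: for the other triples [m] does not
    involve [x_i], so that the form is monic in [x_i]. *)
Definition proper (h : form) : bool := h.2.2 != Some h.1.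

(** The substitution of [m] for [x_i], which is a projection onto the zeros of
    a proper form [x_i - m]. *)
Definition project h x : point :=
  fun k => if k == h.1 then input_eval (with_zero x) h.2 else x k.

Lemma form_eval_project h x : proper h -> form_eval h (project h x) = 0.
Proof.
case: h => i [b [j|]]; rewrite /proper /form_eval /project /input_eval /=.
  by rewrite (inj_eq Some_inj) eqxx => /negPf ->; case: b; rewrite subrr.
by rewrite eqxx subrr.
Qed.

Lemma form_eval_linear h : linear_form (form_eval h).
Proof.
move=> a b t; case: h => i [[] [j|]];
  rewrite /form_eval /input_eval /with_zero /=;
  rewrite -?[(a + t *: b) _]/(a _ + t * b _); ring.
Qed.

Lemma form_eval_neq0 h : proper h -> exists v, form_eval h v != 0.
Proof.
move=> ph; exists (fun k => (k == h.1)%:R).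
rewrite /form_eval /input_eval eqxx /=.
case: h ph => i [b [j|]]; rewrite /proper /=.
  rewrite (inj_eq Some_inj) => /negPf ->.
  by case: b; rewrite /= mulr0n !oppr0 addr0 oner_eq0.
by move=> _; case: b; rewrite !oppr0 addr0 oner_eq0.
Qed.

(** [int_poly s f] says that [f] is the function of an integer polynomial of
    degree less than [s], as for the size of a univariate polynomial. *)
Inductive int_poly : nat -> (point -> C) -> Prop :=
  | IntPoly0 s : int_poly s (fun=> 0)
  | IntPolyC s (c : int) : int_poly s.+1 (fun=> c%:~R)
  | IntPolyD s f g : int_poly s f -> int_poly s g ->
      int_poly s (fun x => f x + g x)
  | IntPolyMX s i f : int_poly s f -> int_poly s.+1 (fun x => x i * f x).

Lemma int_poly_eq s f g : int_poly s f -> (forall x, f x = g x) -> int_poly s g.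
Proof. by move=> pf /funext <-. Qed.

Lemma int_polyS s f : int_poly s f -> int_poly s.+1 f.
Proof.
elim=> {s f} [s|s c|s f g _ Pf _ Pg|s i f _ Pf].
- exact: IntPoly0.
- exact: IntPolyC.
- exact: IntPolyD.
- exact: IntPolyMX.
Qed.

Lemma int_polyW s r f : (s <= r)%N -> int_poly s f -> int_poly r f.
Proof.
move=> /subnK <-; elim: (r - s)%N => // k IHk pf.
by rewrite addSn; apply/int_polyS/IHk.
Qed.

Lemma int_poly_size0 f : int_poly 0 f -> forall x, f x = 0.
Proof.
suff gen s : int_poly s f -> s = 0%N -> forall x, f x = 0 by move/gen; apply.
elim=> {s f} [//|//|s f g _ IHf _ IHg s0 x|//].
by rewrite IHf ?IHg ?addr0.
Qed.

Lemma int_polyN s f : int_poly s f -> int_poly s (fun x => - f x).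
Proof.
elim=> {s f} [s|s c|s f g _ Pf _ Pg|s i f _ Pf].
- by apply: int_poly_eq (IntPoly0 s) _ => x; rewrite oppr0.
- by apply: int_poly_eq (IntPolyC s (- c)) _ => x; rewrite mulrNz.
- by apply: int_poly_eq (IntPolyD Pf Pg) _ => x; rewrite opprD.
- by apply: int_poly_eq (IntPolyMX i Pf) _ => x; rewrite mulrN.
Qed.

Lemma int_poly_project s f h :
  int_poly s f -> int_poly s (fun x => f (project h x)).
Proof.
elim=> {s f} [s|s c|s f g _ Pf _ Pg|s i f _ Pf].
- exact: IntPoly0.
- exact: IntPolyC.
- exact: IntPolyD.
have [ih|ih] := eqVneq i h.1; last first.
  by apply: int_poly_eq (IntPolyMX i Pf) _ => x; rewrite {2}/project (negPf ih).
have pi x : project h x i = input_eval (with_zero x) h.2.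
  by rewrite /project ih eqxx.
case: h.2 pi => [b [j|]] pi; [case: b pi => pi|].
- apply: int_poly_eq (int_polyN (IntPolyMX j Pf)) _ => x.
  by rewrite pi /input_eval /= mulNr.
- by apply: int_poly_eq (IntPolyMX j Pf) _ => x; rewrite pi.
- apply: int_poly_eq (IntPoly0 _) _ => x.
  by rewrite pi /input_eval /=; case: (b); rewrite ?oppr0 mul0r.
Qed.

(** Division by a polynomial that is monic in [x_i] leaves integral
    coefficients; the remainder is the value after the substitution of [m] for
    [x_i]. *)
Lemma int_poly_division s f h : int_poly s f ->
  exists2 g, int_poly s.-1 g &
    forall x, f x = f (project h x) + form_eval h x * g x.
Proof.
elim=> {s f} [s|s c|s f1 f2 _ [g1 Pg1 fg1] _ [g2 Pg2 fg2]|s i f Pf [g Pg fg]].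
- by exists (fun=> 0); [exact: IntPoly0 | move=> x; rewrite mulr0 addr0].
- by exists (fun=> 0); [exact: IntPoly0 | move=> x; rewrite mulr0 addr0].
- exists (fun x => g1 x + g2 x); first exact: IntPolyD.
  by move=> x; rewrite fg1 fg2; ring.
case: s Pf Pg => [|s] Pf Pg.
  exists (fun=> 0); first exact: IntPoly0.
  by move=> x; rewrite !(int_poly_size0 Pf) !mulr0 addr0.
have PXg := IntPolyMX i Pg; have [ih|ih] := eqVneq i h.1.
  exists (fun x => f (project h x) + x i * g x).
    exact: IntPolyD (int_poly_project h Pf) PXg.
  by move=> x; rewrite fg {2}/project /form_eval ih eqxx; ring.
exists (fun x => x i * g x) => // x.
by rewrite fg {2}/project (negPf ih); ring.
Qed.

Lemma int_poly_at0 s f : int_poly s f -> exists c : int, f (fun=> 0) = c%:~R.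
Proof.
elim=> {s f} [s|s c|s f g _ [c ->] _ [d ->]|s i f _ _].
- by exists 0.
- by exists c.
- by exists (c + d); rewrite rmorphD.
- by exists 0; rewrite mul0r.
Qed.

Lemma int_poly_lines s f : int_poly s f -> poly_on_lines f.
Proof.
elim=> {s f} [s|s c|s f g _ Pf _ Pg|s i f _ Pf].
- exact: poly_on_lines_cst.
- exact: poly_on_lines_cst.
- exact: poly_on_linesD.
- by apply: poly_on_linesM Pf; apply: poly_on_lines_linear.
Qed.

Lemma int_poly_monomial (r : seq 'I_n) (m : 'I_n -> nat) (c : int) :
  exists s, int_poly s (fun x => c%:~R * \prod_(i <- r) x i ^+ m i).
Proof.
elim: r => [|i r [s Ps]].
  exists 1%N; apply: int_poly_eq (IntPolyC 0 c) _ => x.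
  by rewrite big_nil mulr1.
have exp k :
    int_poly (k + s) (fun x => x i ^+ k * (c%:~R * \prod_(j <- r) x j ^+ m j)).
  elim: k => [|k IHk]; last first.
    by apply: int_poly_eq (IntPolyMX i IHk) _ => x; rewrite exprS mulrA.
  by apply: int_poly_eq Ps _ => x; rewrite expr0 mul1r.
exists (m i + s)%N; apply: int_poly_eq (exp _) _ => x.
by rewrite big_cons mulrCA.
Qed.

Lemma poly_eval_int_poly (p : {mpoly int[n]}) :
  exists s, int_poly s (@poly_eval R n p).
Proof.
elim/mpolyind: p => [|c m p _ _ [s Ps]].
  exists 0%N; apply: int_poly_eq (IntPoly0 0) _ => x.
  by rewrite /poly_eval rmorph0 meval0.
have [r Pr] := int_poly_monomial (index_enum 'I_n) m c.
exists (maxn r s); have Pr' := int_polyW (leq_maxl r s) Pr.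
apply: int_poly_eq (IntPolyD Pr' (int_polyW (leq_maxr r s) Ps)) _ => x.
rewrite /poly_eval rmorphD /= map_mpolyZ map_mpolyX mevalD mevalZ.
by rewrite mevalX.
Qed.

Lemma poly_eval_at0 (p : {mpoly int[n]}) :
  @poly_eval R n p (fun=> 0) = (p@_0%MM)%:~R.
Proof.
elim/mpolyind: p => [|c m p _ _]; rewrite /poly_eval.
  by rewrite rmorph0 meval0 mcoeff0.
rewrite rmorphD /= map_mpolyZ map_mpolyX mevalD mevalZ mevalX => ->.
rewrite mcoeffD mcoeffZ mcoeffX rmorphD rmorphM /=; congr (_ * _ + _).
have [->|m0] := eqVneq m 0%MM.
  by rewrite big1 // => i _; rewrite mnm0E expr0.
have [i mi] : exists i, m i != 0%N.
  by apply/existsP; apply: contraNT m0 => /existsPn m0; apply/eqP/mnmP => i;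
     rewrite mnm0E; apply/eqP/negPn/m0.
by rewrite (bigD1 i) //= expr0n (negPf mi) mul0r.
Qed.

(** A nonconstant [f] vanishes on the zeros of some form, so that the remainder
    in the division by this form is 0; the quotient satisfies the same hypotheses
    and has smaller size. When only a constant is left, it is an integer, as the
    value at 0 of an integer polynomial. *)
Lemma int_poly_factor s f :
  int_poly s f -> (exists x, f x != 0) ->
  (forall x, f x = 0 -> exists2 h, proper h & form_eval h x = 0) ->
  exists (c : int) (hs : seq form),
    forall x, f x = c%:~R * \prod_(h <- hs) form_eval h x.
Proof.
elim: s f => [|s IHs] f Pf [x0 fx0] zf.
  by rewrite (int_poly_size0 Pf) eqxx in fx0.
have [[a [b ab]]|cstf] := pselect (exists a b, f a != f b); last first.
  have [c f0] := int_poly_at0 Pf; exists c, [::] => x.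
  rewrite big_nil mulr1 -f0; apply/eqP/negP => /negP fx.
  by apply: cstf; exists x, (fun=> 0).
have [|h _|h|x /zf [h ph hx]|h] := @hyperplane_in_zeros C point _
    [seq h <- enum {: form} | proper h] form_eval f (int_poly_lines Pf).
- by exists a, b.
- exact: form_eval_linear.
- by rewrite mem_filter => /andP[/form_eval_neq0].
- by exists h => //; rewrite mem_filter ph mem_enum.
rewrite mem_filter => /andP[ph _] fh.
have [g Pg fE] := int_poly_division h Pf.
have {}fE x : f x = form_eval h x * g x.
  by rewrite fE fh ?add0r // form_eval_project.
have [|||c [hs gE]] := IHs g.
- exact: Pg.
- by exists x0; apply: contraNneq fx0 => gx0; rewrite fE gx0 mulr0.
- by move=> x gx; apply: zf; rewrite fE gx mulr0.
by exists c, (h :: hs) => x; rewrite big_cons fE gE mulrCA.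
Qed.

End IntegerPolynomials.

(** * Runs with generic rounding errors *)

Section GenericErrors.
Variable R : realType.
Local Notation C := R[i].

(** The equalities between quantities, possibly negated, on which the course of
    a run depends. With [u = v] the second one says that [e u] is zero. *)
Definition same_pattern (V : Type) (e e' : V -> C) : Prop :=
  forall u v, (e u == e v) = (e' u == e' v) /\
    (e u == - e v) = (e' u == - e' v).

Lemma eqrN_eq0 (z : C) : (z == - z) = (z == 0).
Proof. by rewrite -addr_eq0 -mulr2n mulrn_eq0. Qed.

Lemma same_pattern_eq0 (V : Type) (e e' : V -> C) u :
  same_pattern e e' -> (e u == 0) = (e' u == 0).
Proof. by move=> pat; rewrite -!eqrN_eq0 (pat u u).2. Qed.

(** A sum or a difference vanishes when its inputs are opposite or equal, a
    product when an input vanishes, and the pattern records all of this. *)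
Lemma op_eval_eq0 (V : Type) (e e' : V -> C) op u v : same_pattern e e' ->
  (op_eval op (input_eval e u) (input_eval e v) == 0) =
  (op_eval op (input_eval e' u) (input_eval e' v) == 0).
Proof.
case: u v => [b u] [c v] pat; have [eqE oppE] := pat u v.
case: op; case: b; case: c; rewrite /input_eval /= ?mulf_eq0 ?oppr_eq0
  ?(same_pattern_eq0 u pat) ?(same_pattern_eq0 v pat) //
  ?subr_eq0 ?addr_eq0 ?opprK ?eqr_opp ?eqr_oppLR ?opprK ?eqE ?oppE //.
Qed.

Definition extend (V : Type) (e : V -> C) (r : C) : option V -> C :=
  fun w => if w is Some w' then e w' else r.

(** A new quantity that is zero or generic creates no equality beyond those that
    its vanishing imposes. *)
Lemma same_pattern_extend (V : Type) (e e' : V -> C) r r' :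
  same_pattern e e' -> (r == 0) = (r' == 0) ->
  (forall u, r != 0 -> (r != e u) && (r != - e u)) ->
  (forall u, r' != 0 -> (r' != e' u) && (r' != - e' u)) ->
  same_pattern (extend e r) (extend e' r').
Proof.
move=> pat r0 fr fr'.
have new u : (r == e u) = (r' == e' u) /\ (r == - e u) = (r' == - e' u).
  have [rz|rn] := eqVneq r 0.
    move: r0; rewrite rz eqxx => /esym/eqP ->.
    by rewrite ![0 == _]eq_sym !oppr_eq0 (same_pattern_eq0 u pat).
  have /andP[/negPf -> /negPf ->] := fr u rn.
  by have /andP[/negPf -> /negPf ->] : (r' != e' u) && (r' != - e' u)
    by apply: fr'; rewrite -r0.
move=> [u|] [v|] /=.
- exact: pat.
- by rewrite ![e _ == _]eq_sym ![e' _ == _]eq_sym ![- _ == _]eqr_oppLR;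
     apply: new.
- exact: new.
- by rewrite !eqxx !eqrN_eq0.
Qed.

Lemma small_avoiding (s : seq C) (eps : R) : 0 < eps ->
  exists2 d : C, `|d| <= eps%:C%C & d \notin s.
Proof.
move=> eps0; pose t := [seq (eps / k.+1%:R)%:C%C | k <- iota 0 (size s).+1].
have ut : uniq t.
  rewrite map_inj_uniq ?iota_uniq // => j k [].
  move=> /(mulfI (lt0r_neq0 eps0)) /invr_inj.
  by move=> /eqP; rewrite eqr_nat => /eqP [].
have [/allP sub|] := boolP (all (mem s) t).
  by have := uniq_leq_size ut sub; rewrite size_map size_iota ltnn.
rewrite -has_predC => /hasP[_ /mapP[k _ ->] /= ks].
exists ((eps / k.+1%:R)%:C%C) => //.
rewrite normc_def /= expr0n addr0 sqrtr_sqr lecR ger0_norm.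
  by rewrite ler_pdivrMr // ler_peMr ?(ltW eps0) // ler1n.
by rewrite divr_ge0 // ltW.
Qed.

(** The errors are chosen node by node along the run, each so small and so
    generic that the new values in both runs, unless zero, avoid the finite set
    of the values computed before and their opposites. The two runs then take
    the same branches. *)
Lemma generic_errors (V : Type) (a : algorithm V) (e e' : V -> C) (s : seq C)
    (eps : R) :
  0 < eps -> (forall u, e u \in s) -> (forall u, e' u \in s) ->
  same_pattern e e' ->
  exists2 delta : comp_node a -> C, forall k, `|delta k| <= eps%:C%C &
    (p_comp a e delta == 0) = (p_comp a e' delta == 0).
Proof.
move=> eps0; elim: a e e' s => {V}
  [V v|V op u v a IHa|V u v a IHa b IHb] e e' s es e's pat.
- by exists (fun=> 0) => [[]|/=]; rewrite (same_pattern_eq0 v pat).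
- set r := op_eval op (input_eval e u) (input_eval e v).
  set r' := op_eval op (input_eval e' u) (input_eval e' v).
  have rr' : (r == 0) = (r' == 0) by apply: op_eval_eq0.
  (* the errors [d] for which [x * (1 + d)] is an old value or its opposite *)
  pose bad (x : C) := [seq z / x - 1 | z <- s ++ map -%R s].
  have [d de] := small_avoiding (-1 :: bad r ++ bad r') eps0.
  rewrite inE mem_cat !negb_or => /and3P[d1 dr dr'].
  have d1' : 1 + d != 0 by rewrite addrC addr_eq0.
  have avoid x (f : V -> C) w : d \notin bad x -> (forall u, f u \in s) ->
      x * (1 + d) != 0 -> (x * (1 + d) != f w) && (x * (1 + d) != - f w).
    move=> dx fs; rewrite mulf_eq0 (negPf d1') orbF => x0.
    have out z : z \in s ++ map -%R s -> x * (1 + d) != z.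
      move=> zs; apply: contra dx => /eqP xz; apply/mapP; exists z => //.
      by rewrite -xz [x * _]mulrC mulfK // addrC addKr.
    by rewrite !out // mem_cat ?fs // map_f ?orbT.
  have [|||delta dle pE] := IHa
      (extend e (r * (1 + d))) (extend e' (r' * (1 + d)))
      [:: r * (1 + d), r' * (1 + d) & s].
  + by move=> [w|] /=; rewrite !inE ?es ?eqxx ?orbT.
  + by move=> [w|] /=; rewrite !inE ?e's ?eqxx ?orbT.
  + apply: same_pattern_extend => //; first by rewrite !mulf_eq0 rr'.
    * by move=> w; apply: avoid.
    * by move=> w; apply: avoid.
  exists (fun k => if k is Some k' then delta k' else d) => [[k|]|] //=.
case euv : (e u == e v).
- have [delta dle pE] := IHa e e' s es e's pat.
  exists (fun k => if k is inl k' then delta k' else 0) => [[k|k]|] //=.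
    by rewrite normr0 lecR ltW.
  by rewrite -(pat u v).1 euv.
- have [delta dle pE] := IHb e e' s es e's pat.
  exists (fun k => if k is inr k' then delta k' else 0) => [[k|k]|] //=.
    by rewrite normr0 lecR ltW.
  by rewrite -(pat u v).1 euv.
Qed.
End GenericErrors.

(** * Zeros of accurately evaluable polynomials *)

Section Necessity.
Variables (R : realType) (n : nat).
Local Notation C := R[i].
Implicit Types x y : 'I_n -> C.

(** At [x] the output is 0 whatever the errors are, hence it is 0 at [y] for
    some small errors, and a relative error below 1 is then impossible unless
    the exact value is 0. *)
Lemma accurate_zero_pattern (a : algorithm 'I_n) (p : {mpoly int[n]}) x y :
  accurate a p [set: 'I_n -> C] -> same_pattern x y ->
  poly_eval p x = 0 -> poly_eval p y = 0.
Proof.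
move=> acc pat px.
have [|eps /andP[eps0 _] bnd] := acc 2^-1.
  by rewrite invr_gt0 ltr0n invf_lt1 // ltr1n.
have [||delta dle pE] :=
  generic_errors a (s := codom x ++ codom y) eps0 _ _ pat.
- by move=> u; rewrite mem_cat codom_f.
- by move=> u; rewrite mem_cat codom_f orbT.
have xz : p_comp a x delta = 0.
  have := bnd x I delta dle; rewrite px normr0 mulr0 subr0.
  by rewrite normr_le0 => /eqP.
have := bnd y I delta dle; move: pE; rewrite xz eqxx => /esym/eqP ->.
rewrite sub0r normrN; have [//|ynz] := eqVneq (poly_eval p y) 0.
rewrite ler_pMl ?normr_gt0 // -[1]/(1%:C%C) lecR.
by rewrite lt_geF // invf_lt1 // ltr1n.
Qed.

(** A generic point of the line from [x] to [y] has the pattern of [x], and it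
    can be chosen such that [p] is nonzero there if [p] is nonzero at [y]. *)
Lemma accurate_zero_specialization (a : algorithm 'I_n)
    (p : {mpoly int[n]}) x y :
  accurate a p [set: 'I_n -> C] ->
  (forall h : form n, form_eval h x = 0 -> form_eval h y = 0) ->
  poly_eval p x = 0 -> poly_eval p y = 0.
Proof.
move=> acc spec px; have [//|py] := eqVneq (poly_eval p y) 0.
have [s Ps] := poly_eval_int_poly R p.
pose F (o : option (form n)) (z : 'I_n -> C) :=
  if o is Some h then form_eval h z else poly_eval p z.
pose line (t : C^o) : 'I_n -> C := x + t *: (y - x).
have line0 : line 0 = x by rewrite /line scale0r addr0.
have line1 : line 1 = y by rewrite /line scale1r addrC addrNK.
have [|o|t nz] := @common_nonzero C C^o _
  [seq o <- enum {: option (form n)} |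
    if o is Some h then form_eval h x != 0 else true]
  (fun o t => F o (line t)).
- move=> o _; apply: (@poly_on_lines_comp _ _ _ line (F o)).
    move=> b c; exists (c *: (y - x)) => t.
    by rewrite /line scalerDl addrA scalerA.
  case: o => [h|]; first exact/poly_on_lines_linear/form_eval_linear.
  exact: int_poly_lines Ps.
- rewrite mem_filter; case: o => [h|_].
    by move=> /andP[hx _]; exists 0; rewrite line0.
  by exists 1; rewrite line1.
have patE (h : form n) : (form_eval h x == 0) = (form_eval h (line t) == 0).
  have [hx|hx] := eqVneq (form_eval h x) 0; last first.
    have nh : form_eval h (line t) != 0.
      by apply: (nz (Some h)); rewrite mem_filter hx mem_enum.
    by rewrite (negPf nh).
  rewrite form_eval_linear -scaleN1r form_eval_linear hx (spec h hx).
  by rewrite !(mulr0, addr0) eqxx.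
have pat : same_pattern x (line t).
  move=> u v; split.
    have := patE (u, (false, Some v)).
    by rewrite /form_eval /input_eval /= !subr_eq0.
  have := patE (u, (true, Some v)).
  by rewrite /form_eval /input_eval /= !subr_eq0.
have := nz None; rewrite mem_filter mem_enum /= => /(_ isT).
by rewrite (accurate_zero_pattern acc pat px) eqxx.
Qed.
End Necessity.

(** * Accurate programs for products of forms *)

Section Programs.
Variable R : realType.
Local Notation C := R[i].

Definition within (eps : R) (u k : C) : Prop := `|u - k| <= eps%:C%C.

Lemma within_le (eps eta : R) u k :
  eps <= eta -> within eps u k -> within eta u k.
Proof. by rewrite /within => le uk; apply: le_trans uk _; rewrite lecR. Qed.

Lemma norm_realE (z : C) : exists2 M : R, 0 <= M & `|z| = M%:C%C.
Proof.
case: z => a b; rewrite normc_def; eexists; last by [].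
exact: sqrtr_ge0.
Qed.

Lemma withinM (k l : C) (eta : R) : 0 < eta ->
  exists2 eps : R, 0 < eps & forall u v, within eps u k -> within eps v l ->
    within eta (u * v) (k * l).
Proof.
move=> eta0; have [M M0 kM] := norm_realE k; have [L L0 lL] := norm_realE l.
pose eps := eta / (1 + L + M + eta).
have D0 : 0 < 1 + L + M + eta by lra.
have eps0 : 0 < eps by rewrite divr_gt0.
have eps1 : eps <= 1 by rewrite ler_pdivrMr //; lra.
have epsD : eps * (1 + L + M + eta) = eta by rewrite divfK // gt_eqF.
clearbody eps; exists eps => // u v uk vl; rewrite /within.
have -> : u * v - k * l = (u - k) * (v - l) + (u - k) * l + k * (v - l) by ring.
apply: le_trans (_ : (eps * eps + eps * L + M * eps)%:C%C <= _); last first.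
  by rewrite lecR; nra.
rewrite !rmorphD !rmorphM /= -kM -lL.
apply: le_trans (ler_normD _ _) _; apply: lerD; last first.
  by rewrite normrM; apply: ler_wpM2l.
apply: le_trans (ler_normD _ _) _; apply: lerD; rewrite normrM.
  exact: ler_pM.
exact: ler_wpM2r.
Qed.

(** The quantities [acc] and [sum] carry the values [P * u] and [P * w] with the
    same exact factor [P], so that adding [acc] to [sum] acts on the
    factors [u] and [w] alone and the errors stay relative to [P], however small
    [P] is. *)
Lemma sum_phase (b : bool) (m : nat) (c : int) (V : Type) (acc sum : V) :
  exists a : algorithm V, forall eta : R, 0 < eta ->
  exists2 eps : R, 0 < eps & forall (e : V -> C) (P u w : C) delta,
    e acc = P * u -> e sum = P * w -> within eps u 1 -> within eps w c%:~R ->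
    (forall k, `|delta k| <= eps%:C%C) ->
    exists2 u', within eta u' (c + (-1) ^+ b * m%:Z)%:~R &
      p_comp a e delta = P * u'.
Proof.
elim: m c V acc sum => [|m IHm] c V acc sum.
  exists (Output sum) => eta eta0; exists eta => // e P u w delta _ sumE _ wc _.
  by exists w; rewrite ?mulr0 ?addr0.
pose c' := c + (-1) ^+ b.
have [a aE] := IHm c' (option V) (Some acc) None.
exists (Compute Add (b, acc) (false, sum) a) => eta eta0.
have [eps1 eps10 {}aE] := aE eta eta0.
have [eps2 eps20 mulE] := withinM c'%:~R 1 eps10.
pose eps := Num.min eps1 (eps2 / 2).
have le1 : eps <= eps1 by rewrite ge_min lexx.
have le2 : eps <= eps2 / 2 by rewrite ge_min lexx orbT.
exists eps; first by rewrite lt_min eps10 divr_gt0.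
move=> e P u w delta accE sumE u1 wc deltaE /=.
pose v := (-1) ^+ b * u + w.
have vc : within eps2 v c'%:~R.
  rewrite /within /v /c' rmorphD rmorphXn /= rmorphN1.
  have -> : (-1) ^+ b * u + w - (c%:~R + (-1) ^+ b) =
    (-1) ^+ b * (u - 1) + (w - c%:~R).
    by ring.
  apply: le_trans (ler_normD _ _) _; rewrite normrM normrX normrN1 expr1n mul1r.
  apply: le_trans (lerD u1 wc) _; rewrite -rmorphD lecR /=; lra.
set e1 := (fun w0 : option V => _).
have e1sum : e1 None = P * (v * (1 + delta None)).
  rewrite /e1 /input_eval /= accE sumE /v.
  by case: (b); rewrite ?expr1 ?expr0; ring.
have wc1 : within eps1 (v * (1 + delta None)) c'%:~R.
  rewrite -[X in within _ _ X]mulr1; apply: mulE => //.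
  by rewrite /within addrC addKr; apply: le_trans (deltaE None) _;
     rewrite lecR; lra.
have dE k : `|delta (Some k)| <= eps1%:C%C.
  by apply: le_trans (deltaE _) _; rewrite lecR.
have [u' u'c ->] := aE e1 P u _ _ accE e1sum (within_le le1 u1) wc1 dE.
exists u' => //.
rewrite -(_ : c' + (-1) ^+ b * m%:Z = c + (-1) ^+ b * m.+1%:Z) //.
by rewrite /c' -[m.+1]addn1 PoszD; ring.
Qed.

Section ProductPhase.
Variable n : nat.

Lemma form_input (V : Type) (src : option 'I_n -> V) (e : V -> C) x
    (h : form n) :
  (forall o, e (src o) = with_zero x o) ->
  input_eval e (false, src (Some h.1)) - input_eval e (h.2.1, src h.2.2) =
  form_eval h x.
Proof. by move=> srcE; rewrite /form_eval /input_eval /= !srcE. Qed.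

(** The running product [acc] has the value [P * u], with [P] exact and [u] close
    to 1; forms are multiplied into it one by one, and the last step forms
    the multiple by [c], summing from [src None], which holds an exact zero. *)
Lemma product_phase (c : int) (hs : seq (form n)) (V : Type)
    (src : option 'I_n -> V) (acc : V) :
  exists a : algorithm V, forall eta : R, 0 < eta ->
  exists2 eps : R, 0 < eps & forall (e : V -> C) x (P u : C) delta,
    (forall o, e (src o) = with_zero x o) -> e acc = P * u -> within eps u 1 ->
    (forall k, `|delta k| <= eps%:C%C) ->
    exists2 u', within eta u' c%:~R &
      p_comp a e delta = P * \prod_(h <- hs) form_eval h x * u'.
Proof.
elim: hs V src acc => [|h hs IHhs] V src acc.
  have [a aE] := sum_phase (c < 0) `|c|%N 0 acc (src None).
  exists a => eta eta0; have [eps eps0 {}aE] := aE eta eta0.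
  exists eps => // e x P u delta srcE accE u1 deltaE.
  have [||u' u'c ->] := aE e P u 0 delta accE _ u1 _ deltaE.
  - by rewrite srcE mulr0.
  - by rewrite /within subrr normr0 lecR ltW.
  exists u'; last by rewrite big_nil mulr1.
  by rewrite add0r -intEsign in u'c.
have [a aE] := IHhs (option (option V)) (fun o => Some (Some (src o))) None.
exists (Compute Defs.Sub (false, src (Some h.1)) (h.2.1, src h.2.2)
       (Compute Mul (false, None) (false, Some acc) a)) => eta eta0.
have [eps1 eps10 {}aE] := aE eta eta0.
have [eps2 eps20 mul2] := withinM 1 1 eps10.
have [eps3 eps30 mul3] := withinM 1 1 eps20.
pose eps := Num.min eps1 (Num.min eps2 eps3).
have le1 : eps <= eps1 by rewrite ge_min lexx.
have le2 : eps <= eps2 by rewrite !ge_min lexx orbT.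
have le3 : eps <= eps3 by rewrite !ge_min lexx !orbT.
exists eps; first by rewrite !lt_min eps10 eps20.
move=> e x P u delta srcE accE u1 deltaE.
have near1 k : within eps (1 + delta k) 1 by rewrite /within addrC addKr.
have := form_input h srcE; rewrite /= => ->.
set e1 := (fun w : option (option V) => _).
have e1acc : e1 None =
    P * form_eval h x * (u * (1 + delta None) * (1 + delta (Some None))).
  by rewrite /e1 /input_eval /= accE; ring.
have w1 : within eps1 (u * (1 + delta None) * (1 + delta (Some None))) 1.
  rewrite -[X in within _ _ X]mulr1; apply: mul2; last exact: within_le (near1 _).
  rewrite -[X in within _ _ X]mulr1.
  by apply: mul3; [apply: within_le u1 | apply: within_le (near1 _)].
have dE k : `|delta (Some (Some k))| <= eps1%:C%C.
  by apply: le_trans (deltaE _) _; rewrite lecR.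
have [u' u'c ->] := aE e1 x _ _ _ srcE e1acc w1 dE.
by exists u' => //; rewrite big_cons mulrA.
Qed.

(** Accuracy for every tolerance includes the run without errors. *)
Lemma accurate_algorithm_for (a : algorithm 'I_n) (p : {mpoly int[n]}) :
  accurate a p [set: 'I_n -> C] -> algorithm_for R a p.
Proof.
move=> acc x; apply/eqP; rewrite -subr_eq0 -normr_eq0.
have [A A0 dA] := norm_realE (p_comp a x (fun=> 0) - poly_eval p x).
have [B B0 pB] := norm_realE (poly_eval p x).
rewrite dA -[0]/(0%:C%C) (inj_eq (@complexI _)).
have [//|An0] := eqVneq A 0.
have {A0 An0} A0 : 0 < A by rewrite lt_def An0.
have D0 : 0 < 2 * (A + B) by lra.
have [|eps /andP[eps0 _] bnd] := acc (A / (2 * (A + B))).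
  by rewrite divr_gt0 // ltr_pdivrMr //; lra.
have := bnd x I (fun=> 0) (fun _ => _); rewrite normr0 dA pB -rmorphM.
rewrite !lecR ltW // => /(_ (fun=> isT)).
rewrite mulrAC ler_pdivlMr // ler_pM2l // => le.
by have : A < 0 by [lra]; rewrite ltNge ltW.
Qed.

Lemma zero_evaluable (p : {mpoly int[n]}) (i : 'I_n) :
  (forall x : 'I_n -> C, poly_eval p x = 0) ->
  accurately_evaluable p [set: 'I_n -> C].
Proof.
move=> p0; suff acc : accurate (Compute Defs.Sub (false, i) (false, i) (Output None))
    p [set: 'I_n -> C].
  by eexists; [exact: accurate_algorithm_for acc | exact: acc].
move=> eta _; exists 2^-1.
  by rewrite invr_gt0 ltr0n invf_lt1 // ltr1n.
by move=> x _ delta _; rewrite p0 /= subrr mul0r subrr !normr0 mulr0.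
Qed.

(** The first node computes the exact zero [x_i - x_i], the second one the first
    form. Since [1 <= `|c|], an error of [eta] in the factor [u'] close to [c] is
    at most [eta] relative to [c]. *)
Lemma product_evaluable (p : {mpoly int[n]}) (c : int) (h : form n)
    (hs : seq (form n)) :
  c != 0 ->
  (forall x : 'I_n -> C,
    poly_eval p x = c%:~R * \prod_(g <- h :: hs) form_eval g x) ->
  accurately_evaluable p [set: 'I_n -> C].
Proof.
move=> c0 pE.
have [a aE] := product_phase c hs (fun o : option 'I_n => Some o) None.
pose body := Compute Defs.Sub (false, Some h.1) (h.2.1, h.2.2) a.
pose full := Compute Defs.Sub (false, h.1) (false, h.1)
  body.
suff acc : accurate full p [set: 'I_n -> C].
  by exists full => //; apply: accurate_algorithm_for.
move=> eta /andP[eta0 _]; have [eps1 eps10 {}aE] := aE eta eta0.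
pose eps := Num.min eps1 2^-1.
have le1 : eps <= eps1 by rewrite ge_min lexx.
exists eps.
  rewrite lt_min eps10 invr_gt0 ltr0n /= gt_min; apply/orP; right.
  by rewrite invf_lt1 // ltr1n.
move=> x _ delta deltaE; rewrite /full /=.
set e1 := (fun w : option 'I_n => _).
have e1E o : e1 o = with_zero x o by case: o => //=; rewrite subrr mul0r.
have := form_input h (src := id) e1E; rewrite /= => ->.
set e2 := (fun w : option (option 'I_n) => _).
have w1 : within eps1 (1 + delta (Some None)) 1.
  by rewrite /within addrC addKr; apply: le_trans (deltaE _) _; rewrite lecR.
have dE k : `|delta (Some (Some k))| <= eps1%:C%C.
  by apply: le_trans (deltaE _) _; rewrite lecR.
have [u' u'c ->] := aE e2 x (form_eval h x) _ _ e1E erefl w1 dE.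
rewrite pE big_cons; set P := form_eval h x * _.
rewrite [c%:~R * P]mulrC -mulrBr 2!(normrM P) mulrCA; apply: ler_wpM2l => //.
apply: le_trans u'c _; apply: ler_peMr; first by rewrite lecR ltW.
by rewrite -intr_norm -[1]/(1%:~R) ler_int -gtz0_ge1 normr_gt0.
Qed.

End ProductPhase.
End Programs.

(** * Allowable varieties *)

Section Allowability.
Variables (R : realType) (n : nat).
Local Notation C := R[i].

Definition form_zeros (h : form n) : set ('I_n -> C) :=
  [set x | form_eval h x = 0].

Lemma basic_allowable_form_zeros (h : form n) : basic_allowable (form_zeros h).
Proof.
case: h => i [b [j|]]; last first.
  constructor 1; exists i; apply/seteqP; split=> x;
    by rewrite /form_zeros /Zset /form_eval /input_eval /=;
    case: b; rewrite !oppr0 addr0.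
case: b; [constructor 2 | constructor 3]; exists i, j; apply/seteqP; split=> x;
  by rewrite /form_zeros /Sset /Dset /form_eval /input_eval /= ?opprK.
Qed.

(** The point [x0] outside of [A] rules out that [A] is the whole space [D_ii];
    and [S_ii] is [Z_i]. *)
Lemma basic_allowable_proper (A : set ('I_n -> C)) x x0 :
  basic_allowable A -> A x -> ~ A x0 ->
  exists2 h : form n, proper h & form_eval h x = 0.
Proof.
case=> [[i ->]|[i [j ->]]|[i [j ->]]]; rewrite /Zset /Sset /Dset /= => xA x0A.
- by exists (i, (false, None)); rewrite // /form_eval /input_eval /= subr0.
- have [ij|ij] := eqVneq j i.
    exists (i, (false, None)); rewrite // /form_eval /input_eval /= subr0.
    by apply/eqP; move/eqP: xA; rewrite ij -mulr2n mulrn_eq0.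
  exists (i, (true, Some j)); first by rewrite /proper /= (inj_eq Some_inj).
  by rewrite /form_eval /input_eval /= opprK.
- have [ij|ij] := eqVneq j i; first by case: x0A; rewrite ij subrr.
  by exists (i, (false, Some j)); rewrite // /proper /= (inj_eq Some_inj).
Qed.

(** V(p) is the union, over its points [x], of the intersection of all basic
    sets through [x]. *)
Lemma accurately_evaluable_allowable (p : {mpoly int[n]}) :
  accurately_evaluable p [set: 'I_n -> C] -> allowable (variety R p).
Proof.
case=> a _ acc.
exists [set G | exists2 x, variety R p x &
                  G = [set A | exists2 h, A = form_zeros h & form_eval h x = 0]].
  by move=> _ [x _ ->] _ [h -> _]; apply: basic_allowable_form_zeros.
apply/seteqP; split=> [x px|y [_ [x px ->] yG]].
  eexists; first by exists x; [exact: px|].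
  by move=> _ [h -> hx].
apply: accurate_zero_specialization acc _ px => h hx.
by apply: (yG (form_zeros h)); exists h.
Qed.

(** Any point where [p] is nonzero lies outside each intersection whose union is
    V(p), so each of these intersections is contained in a proper hyperplane. In
    the factorization at least one form occurs, because [p] vanishes at 0 and
    [c] does not. *)
Lemma allowable_accurately_evaluable (hn : (0 < n)%N) (p : {mpoly int[n]}) :
  p@_0%MM = 0 -> allowable (variety R p) ->
  accurately_evaluable p [set: 'I_n -> C].
Proof.
move=> p0 [F basicF VF].
have [[x0 px0]|pz] :=
  pselect (exists x : 'I_n -> C, poly_eval p x != 0); last first.
  apply: (zero_evaluable (Ordinal hn)) => x; apply/eqP/negP => /negP px.
  by apply: pz; exists x.
have [s Ps] := poly_eval_int_poly R p.
have [||c [hs pE]] := int_poly_factor Ps; first by exists x0.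
  move=> x px; have : variety R p x by [].
  rewrite VF => -[G FG Gx].
  have [A GA x0A] : exists2 A, G A & ~ A x0.
    apply: contrapT => all_x0; move/eqP: px0; apply.
    suff : variety R p x0 by [].
    rewrite VF; exists G => // A GA; apply: contrapT => x0A.
    by apply: all_x0; exists A.
  exact: basic_allowable_proper (basicF _ FG _ GA) (Gx _ GA) x0A.
have c0 : c != 0 by apply: contraNneq px0 => c0; rewrite pE c0 mul0r.
case: hs pE => [|h hs] pE; last exact: product_evaluable c0 pE.
have := poly_eval_at0 R p; rewrite p0 pE big_nil mulr1 => /eqP.
by rewrite intr_eq0 (negPf c0).
Qed.
End Allowability.

Theorem theorem4p21 (R : realType) (n : nat) (hn : (0 < n)%N)
    (p : {mpoly int[n]}) (hp : p@_0%MM = 0) :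
  accurately_evaluable p [set: 'I_n -> R[i]] <-> allowable (variety R p).
Proof.
split; first exact: accurately_evaluable_allowable.
exact: allowable_accurately_evaluable.
Qed.
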